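(* Let $\phi$ be containment preserving and sum preserving. For $Y\in S(M)$, let $\Omega=\{X\in S(M): X \text{ is } \phi\text{-prime},\ Y\subseteq X \text{ and } \phi(Y)=\phi(X)\}$. Then $$\sqrt{Y}=\bigcap_{X\in\Omega}X,$$ where the intersection over an empty $\Omega$ is understood to be $M$.
   Context: $R$ is an associative ring with identity, not necessarily commutative, and $M$ is a unitary right $R$-module. $S(M)$ is the set of all submodules of $M$; ''ideal'' means two-sided ideal. For a submodule $Y$ of $M$ and $I\subseteq R$, $YI$ is the set of finite sums of elements $yr$ with $y\in Y$, $r\in I$. $(X:_{R}M)=\{r\in R: Mr\subseteq X\}$. For a subset $T$ of $M$, $\langle T\rangle$ is the submodule generated by $T$. A function $\phi:S(M)\to S(M)\cup\{\emptyset\}$ is fixed, with the standing convention that $\phi(X)\subseteq X$ for every $X\in S(M)$. $\phi$ is containment preserving if $X_{1}\subseteq X_{2}$ implies $\phi(X_{1})\subseteq\phi(X_{2})$ for $X_1,X_2\in S(M)$; it is sum preserving if $\phi(\sum X_{i})=\sum\phi(X_{i})$ for all families of submodules $X_{i}\in S(M)$. A submodule $X$ of $M$ is $\phi$-prime if it is proper and for every $Y\in S(M)$ and every ideal $I$ of $R$, $YI\subseteq X$ and $YI\nsubseteq\phi(X)$ imply $Y\subseteq X$ or $I\subseteq(X:_{R}M)$. A subset $S$ of $M$ is a $\phi$-$m$-system if $S\neq\emptyset$ and, writing $S^{c}=M\setminus S$, for all $Y_{1},Y_{2}\in S(M)$ and every ideal $I$ of $R$: if $(Y_{1}+Y_{2})\cap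 S\neq\emptyset$, $(Y_{1}+MI)\cap S\neq\emptyset$ and $Y_{2}I\nsubseteq\phi(\langle S^{c}\rangle)$, then $(Y_{1}+Y_{2}I)\cap S\neq\emptyset$. Radical of $Y\in S(M)$: if there is a $\phi$-prime submodule $X$ containing $Y$ with $\phi(Y)=\phi(X)$, then $\sqrt{Y}=\{x\in M: \text{every } \phi\text{-}m\text{-system } S \text{ with } x\in S \text{ and } \phi(Y)=\phi(\langle S^{c}\rangle) \text{ satisfies } S\cap Y\neq\emptyset\}$; otherwise $\sqrt{Y}=M$. *)

(* Defs.v *)
From HB Require Import structures.
From mathcomp Require Export all_boot all_algebra all_classical.

Set Implicit Arguments.
Unset Strict Implicit.
Unset Printing Implicit Defensive.

Import GRing.Theory.
Local Open Scope classical_set_scope.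
Local Open Scope ring_scope.

(* A right R-module is a left module over the converse ring R^c: the right    *)
(* action m r is written [(r : R^c) *: m], and (m r) s = m (r s) holds        *)
(* because the product of s and r in R^c is r * s in R.                       *)

Section RightModules.
Variables (R : pzRingType) (M : lmodType R^c).
Implicit Types (X Y S T : set M) (I : set R) (phi : set M -> set M).

Definition submodules : set (set M) := [set X | GRing.submod_closed [in X]].

Definition ideal I : Prop :=
  GRing.zmod_closed [in I] /\
  (forall r a : R, I a -> I (r * a) /\ I (a * r)).

Definition addset X Y : set M := [set x + y | x in X & y in Y].

Definition mulset Y I : set M :=
  [set x | exists (n : nat) (y : 'I_n -> M) (r : 'I_n -> R),
     (forall k, Y (y k) /\ I (r k)) /\
     x = \sum_(k < n) (r k : R^c) *: y k].

(* Finite sums with at least one term. For a nonempty family of submodules    *)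
(* this is the usual sum; an empty member contributes nothing, and the sum    *)
(* is empty when all members are empty.                                       *)
Definition famsum (J : Type) (A : J -> set M) : set M :=
  [set x | exists (n : nat) (y : 'I_n.+1 -> M),
     (forall k, exists j, A j (y k)) /\ x = \sum_(k < n.+1) y k].

Definition residual X : set R := [set r : R | forall m : M, X ((r : R^c) *: m)].

Definition generated T : set M := smallest submodules T.

(* In the definitions below, only the values of phi at submodules matter. *)

Definition containment_preserving phi : Prop :=
  forall X1 X2, submodules X1 -> submodules X2 -> X1 `<=` X2 ->
    phi X1 `<=` phi X2.

Definition sum_preserving phi : Prop :=
  forall (J : Type) (X : J -> set M), inhabited J ->
    (forall j, submodules (X j)) ->
    phi (famsum X) = famsum (fun j => phi (X j)).

Definition phi_prime phi X : Prop :=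
  submodules X /\ X <> setT /\
  forall Y I, submodules Y -> ideal I ->
    mulset Y I `<=` X -> ~ (mulset Y I `<=` phi X) ->
    Y `<=` X \/ I `<=` residual X.

Definition phi_m_system phi S : Prop :=
  S !=set0 /\
  forall Y1 Y2 I, submodules Y1 -> submodules Y2 -> ideal I ->
    addset Y1 Y2 `&` S !=set0 ->
    addset Y1 (mulset setT I) `&` S !=set0 ->
    ~ (mulset Y2 I `<=` phi (generated (~` S))) ->
    addset Y1 (mulset Y2 I) `&` S !=set0.

Definition radical phi Y : set M :=
  if `[< exists X, [/\ phi_prime phi X, Y `<=` X & phi Y = phi X] >]
  then [set x | forall S, phi_m_system phi S -> S x ->
                  phi Y = phi (generated (~` S)) -> S `&` Y !=set0]
  else setT.

End RightModules.

Arguments submodules {R} M.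

(* Main.v *)
Require Import Defs.
From mathcomp Require Import all_boot all_algebra all_classical.

(** Read contrapositively, the definition of a phi-m-system [S] is the primeness
    condition for the complement of [S], with submodules tested by whether they
    meet [S].  This gives both inclusions.

    If [X] is a phi-prime submodule, its complement is a phi-m-system
    ([setC_phi_prime_m_system]).  When [X] contains [Y] and [phi Y = phi X], this
    system is one of those tested in the radical of [Y] and it is disjoint from
    [Y], so no element of the radical lies outside [X].

    For the other inclusion, let [S] be a phi-m-system disjoint from [Y] with
    [phi Y = phi <S^c>].  Zorn's lemma gives a submodule [X] containing [Y] and
    maximal among those disjoint from [S].  Such an [X] is phi-prime as soon as
    [phi X = phi <S^c>] ([maximal_disjoint_phi_prime]): if [W I] lies in [X]
    although neither [W] nor [M I] does, then [X + W] and [X + M I] are strictly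
    larger than [X], hence both meet [S], and the m-system condition makes
    [X + W I], which is contained in [X], meet [S] as well.  The equality of the
    values of [phi] is automatic for a containment preserving [phi], because [X]
    lies between [Y] and [<S^c>], where [phi] takes the same value.  So [X] is
    one of the submodules being intersected, and no element of [S] belongs to
    the intersection. *)

Set Implicit Arguments.
Unset Strict Implicit.
Unset Printing Implicit Defensive.

Import GRing.Theory.

Local Open Scope classical_set_scope.
Local Open Scope ring_scope.

Section PhiPrimeAndMSystems.
Variables (R : pzRingType) (M : lmodType R^c).
Implicit Types (W X Y Z S T : set M) (I : set R) (phi : set M -> set M).

Lemma submodulesP X :
  submodules M X <->
  X 0 /\ forall (a : R^c) u v, X u -> X v -> X (a *: u + v).
Proof.
split=> [[X0 Xlin]|[X0 Xlin]].
  split=> [|a u v Xu Xv]; first exact: set_mem X0.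
  by apply: set_mem; apply: Xlin; apply: mem_set.
split=> [|a u v /set_mem Xu /set_mem Xv]; first exact: mem_set.
by apply: mem_set; apply: Xlin.
Qed.

Lemma submodule0 X : submodules M X -> X 0.
Proof. by move=> /submodulesP[]. Qed.

Lemma submoduleD X u v : submodules M X -> X u -> X v -> X (u + v).
Proof.
by move=> /submodulesP[_ Xlin] Xu Xv; rewrite -[u]scale1r; apply: Xlin.
Qed.

Lemma generated_id X : submodules M X -> generated X = X.
Proof.
move=> Xsub; apply/seteqP; split; first exact: smallest_sub.
exact: sub_gen_smallest.
Qed.

Lemma generated_submodule T : submodules M (generated T).
Proof.
apply/submodulesP; split=> [A [Asub _]|a u v Tu Tv A [Asub TA]].
  exact: submodule0.
have /submodulesP[_ Alin] := Asub.
by apply: Alin; [apply: Tu | apply: Tv].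
Qed.

Lemma addset_submodule X Y :
  submodules M X -> submodules M Y -> submodules M (addset X Y).
Proof.
move=> /submodulesP[X0 Xlin] /submodulesP[Y0 Ylin]; apply/submodulesP; split.
  by exists 0 => //; exists 0 => //; rewrite addr0.
move=> a _ _ [x Xx [y Yy <-]] [x' Xx' [y' Yy' <-]].
exists (a *: x + x'); first exact: Xlin.
exists (a *: y + y'); first exact: Ylin.
by rewrite scalerDr addrACA.
Qed.

Lemma sub_addsetl X Y : Y 0 -> X `<=` addset X Y.
Proof. by move=> Y0 x Xx; exists x => //; exists 0 => //; rewrite addr0. Qed.

Lemma sub_addsetr X Y : X 0 -> Y `<=` addset X Y.
Proof. by move=> X0 y Yy; exists 0 => //; exists y => //; rewrite add0r. Qed.

Lemma addset_sub X Y Z :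
  submodules M Z -> X `<=` Z -> Y `<=` Z -> addset X Y `<=` Z.
Proof.
move=> Zsub XZ YZ _ [x Xx [y Yy <-]].
by apply: submoduleD => //; [apply: XZ | apply: YZ].
Qed.

Lemma mulset0 Y I : mulset Y I 0.
Proof.
exists 0%N, (fun=> 0), (fun=> 0); split; first by case.
by rewrite big_ord0.
Qed.

Lemma mem_mulset Y I (y : M) (r : R) :
  Y y -> I r -> mulset Y I ((r : R^c) *: y).
Proof.
move=> Yy Ir; exists 1%N, (fun=> y), (fun=> r); split=> //.
by rewrite big_ord1.
Qed.

(** The identity [(y r) a = y (r a)] moves an outer scalar into the ideal. *)
Lemma mulset_submodule Y I : ideal I -> submodules M (mulset Y I).
Proof.
move=> [_ Imul]; apply/submodulesP; split; first exact: mulset0.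
move=> a _ _ [m [y [r [Yr ->]]]] [n [z [s [Zs ->]]]].
pose y' k := match fintype.split k with inl i => y i | inr j => z j end.
pose r' k := match fintype.split k with inl i => (r i : R) * (a : R) | inr j => s j end.
exists (m + n)%N, y', r'; split.
  move=> k; rewrite /y' /r'; case: (fintype.split k) => [i|j]; last exact: Zs.
  by have [Yi Ii] := Yr i; split=> //; have [] := Imul a _ Ii.
rewrite big_split_ord scaler_sumr; congr (_ + _); apply: eq_bigr => i _.
  by rewrite /y' /r' (unsplitK (inl i)) scalerA.
by rewrite /y' /r' (unsplitK (inr i)).
Qed.

Lemma mulset_residual X I : mulset setT I `<=` X -> I `<=` residual X.
Proof. by move=> MIX r Ir m; apply: MIX; apply: mem_mulset. Qed.

Lemma meets_setC X Z : Z `&` ~` X !=set0 <-> ~ (Z `<=` X).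
Proof. by split=> [[x [Zx Xx]] /(_ x Zx)|/nonsubset]. Qed.

(** As [X] is a submodule, [X = <X>] is the submodule generated by the
    complement of the system, so the two conditions on [phi] coincide; a
    submodule meets the system exactly when it is not contained in [X]. *)
Lemma setC_phi_prime_m_system phi X : phi_prime phi X -> phi_m_system phi (~` X).
Proof.
move=> [Xsub [XT Xprime]]; split.
  by apply/set0P; apply/eqP => XC0; apply: XT; rewrite -[X]setCK XC0 setC0.
move=> Y1 Y2 I Y1sub Y2sub Iideal /meets_setC Y12 /meets_setC Y1MI.
rewrite setCK generated_id // => Y2I; apply/meets_setC => Y12I.
have Y1X : Y1 `<=` X.
  by apply: subset_trans Y12I; apply/sub_addsetl/mulset0.
have Y2IX : mulset Y2 I `<=` X.
  by apply: subset_trans Y12I; apply: sub_addsetr; apply: submodule0.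
have [Y2X|IX] := Xprime _ _ Y2sub Iideal Y2IX Y2I.
  by apply: Y12; apply: addset_sub.
apply: Y1MI; apply: addset_sub => // _ [n [y [r [yr ->]]]].
apply: (big_ind X) => [|u v|k _]; [exact: submodule0 | exact: submoduleD |].
by apply: IX; have [] := yr k.
Qed.

Lemma exists_maximal_disjoint_submodule Y S :
  submodules M Y -> Y `<=` ~` S ->
  exists X, [/\ submodules M X, Y `<=` X, X `<=` ~` S &
    forall Z, submodules M Z -> X `<=` Z -> Z `<=` ~` S -> Z `<=` X].
Proof.
move=> Ysub YS.
(* Zorn's lemma is applied to sets [A] such that [Y `|` A] is admissible: in
   this form the union of the empty chain is admissible too. *)
pose P A := submodules M (Y `|` A) /\ Y `|` A `<=` ~` S.
have [F FP Ftot|A [[YAsub YAS] Amax]] := @Zorn_bigcup _ P.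
  have FS : Y `|` \bigcup_(A in F) A `<=` ~` S.
    by move=> x [/YS//|[A FA Ax]]; apply: (FP _ FA).2; right.
  split=> //; apply/submodulesP; split; first by left; apply: submodule0.
  have stage A : F A \/ A = set0 -> submodules M (Y `|` A).
    by case=> [/FP[]//|->]; rewrite setU0.
  have sub_stage A : F A \/ A = set0 -> Y `|` A `<=` Y `|` \bigcup_(B in F) B.
    by case=> [FA|->] x [Yx|Ax]; [left | right; exists A | left | ].
  have at_stage x : (Y `|` \bigcup_(B in F) B) x ->
      exists2 A, F A \/ A = set0 & (Y `|` A) x.
    by case=> [Yx|[A FA Ax]]; [exists set0 | exists A]; do ?[by right | by left].
  have comparable A B : F A \/ A = set0 -> F B \/ B = set0 ->
      A `<=` B \/ B `<=` A.
    case=> [FA|->]; last by left.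
    by case=> [FB|->]; [exact: Ftot | right].
  move=> a u v /at_stage[A FA Au] /at_stage[B FB Bv].
  have [AB|BA] := comparable A B FA FB.
    apply: (sub_stage B FB); have /submodulesP[_] := stage B FB; apply=> //.
    exact: (setUS AB).
  apply: (sub_stage A FA); have /submodulesP[_] := stage A FA; apply=> //.
  exact: (setUS BA).
exists (Y `|` A); split=> // Z Zsub YAZ ZS.
apply: contrapT => ZYA; apply: (Amax Z); last first.
  by rewrite /P (setUidr (subset_trans (@subsetUl _ _ _) YAZ)).
split; first by apply: subset_trans YAZ; apply: subsetUr.
by move=> ZA; apply: ZYA => x /ZA; right.
Qed.

(** Maximality turns a failure of primeness, [W] or [M I] not contained in [X],
    into the hypothesis of the m-system condition, [X + W] and [X + M I] meeting
    [S]. *)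
Lemma maximal_disjoint_phi_prime phi S X :
  phi_m_system phi S -> submodules M X -> X `<=` ~` S ->
  (forall Z, submodules M Z -> X `<=` Z -> Z `<=` ~` S -> Z `<=` X) ->
  phi X = phi (generated (~` S)) -> phi_prime phi X.
Proof.
move=> [[s Ss] Ssys] Xsub XS Xmax phiX; split=> //; split.
  by move=> XT; apply: (XS s) => //; rewrite XT.
move=> W I Wsub Iideal WIX WIphi; apply: contrapT => /not_orP[WX IX].
have meetsS Z : submodules M Z -> ~ (Z `<=` X) -> addset X Z `&` S !=set0.
  move=> Zsub ZX; rewrite -[S]setCK; apply/meets_setC => XZS; apply: ZX.
  apply: subset_trans (Xmax _ (addset_submodule Xsub Zsub) _ XZS).
    by apply: sub_addsetr; apply: submodule0.
  by apply: sub_addsetl; apply: submodule0.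
have MIX : ~ (mulset setT I `<=` X) by move=> /mulset_residual.
have [||t [XWIt St]] := Ssys X W I Xsub Wsub Iideal (meetsS _ Wsub WX).
- by apply: meetsS => //; apply: mulset_submodule.
- by rewrite -phiX.
- by apply: (XS t) => //; apply: addset_sub XWIt.
Qed.

End PhiPrimeAndMSystems.

Theorem theorem11 (R : pzRingType) (M : lmodType R^c) (phi : set M -> set M)
  (phi_codom : set_fun (submodules M) (submodules M `|` [set set0]) phi)
  (phi_sub : forall X : set M, submodules M X -> phi X `<=` X)
  (phi_cont : containment_preserving phi)
  (phi_sum : sum_preserving phi)
  (Y : set M) (Y_sub : submodules M Y) :
  let Omega : set (set M) :=
    [set X | submodules M X /\ [/\ phi_prime phi X, Y `<=` X & phi Y = phi X]] in
  radical phi Y = \bigcap_(X in Omega) X.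
Proof.
move=> Omega; rewrite /radical; case: asboolP => [_|Omega0]; last first.
  apply/seteqP; split=> // x _ X [_ OmegaX].
  by case: Omega0; exists X.
apply/seteqP; split=> [x radx X [Xsub [Xprime YX phiYX]]|x capx S Ssys Sx phiYS].
  apply: contrapT => Xx.
  have [|y [Xy /YX //]] := radx _ (setC_phi_prime_m_system Xprime) Xx.
  by rewrite setCK generated_id.
apply: contrapT => SY0.
have YS : Y `<=` ~` S by move=> y Yy Sy; apply: SY0; exists y.
have [X [Xsub YX XS Xmax]] := exists_maximal_disjoint_submodule Y_sub YS.
have phiX : phi X = phi (generated (~` S)).
  apply/seteqP; split; last by rewrite -phiYS; apply: phi_cont.
  apply: phi_cont => //; first exact: generated_submodule.
  by apply: subset_trans XS _; apply: sub_gen_smallest.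
apply: (XS x) => //; apply: capx; split=> //; split=> //; last by rewrite phiX.
exact: maximal_disjoint_phi_prime Ssys Xsub XS Xmax phiX.
Qed.
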